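(* A ring $A$ is a right distributive, right Noetherian, centrally essential ring if and only if $A=A_1\times\cdots\times A_n$ for some positive integer $n$, where each $A_i$ ($i=1,\ldots,n$) is either a uniserial Artinian centrally essential ring or a commutative Dedekind domain. Moreover, in this case $A$ is a distributive Noetherian ring.
   Context: All rings are associative with a non-zero identity element. A ring $A$ with center $C$ is centrally essential if for every non-zero $a\in A$ there are non-zero central elements $c,d\in C$ with $ac=d$ (equivalently, the module $A_C$ is an essential extension of $C_C$). A module is distributive if the lattice of its submodules is distributive; a module is uniserial if any two of its submodules are comparable with respect to inclusion. A ring $A$ is right (left) distributive, right (left) uniserial, right (left) Noetherian or right (left) Artinian if the module $A_A$ (respectively ${}_AA$) has the corresponding property. A ring is called distributive, uniserial, Noetherian or Artinian (without a side) if both modules $A_A$ and ${}_AA$ have the corresponding property. *)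

(* Defs.v *)
From HB Require Import structures.
From mathcomp Require Import all_boot all_algebra.
From mathcomp Require Import boolp classical_sets.

Set Implicit Arguments.
Unset Strict Implicit.
Unset Printing Implicit Defensive.

Import GRing.Theory.

Local Open Scope classical_set_scope.
Local Open Scope ring_scope.

Section Modules.
Variables (R : nzRingType) (M : lmodType R).

(* [I] is an arbitrary Prop-valued set: no decidability is assumed. *)
Definition submodule (I : set M) : Prop := submod_closed [in I].

Definition sum_submodule (I J : set M) : set M := [set x + y | x in I & y in J].

(* Meet and join in the lattice of submodules are intersection and sum. *)
Definition distributive_module : Prop :=
  forall I J K : set M, submodule I -> submodule J -> submodule K ->
    I `&` sum_submodule J K = sum_submodule (I `&` J) (I `&` K).

Definition uniserial_module : Prop :=
  forall I J : set M, submodule I -> submodule J -> I `<=` J \/ J `<=` I.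

Definition noetherian_module : Prop :=
  forall I : nat -> set M,
    (forall k, submodule (I k)) -> (forall k, I k `<=` I k.+1) ->
    exists k, forall m, (k <= m)%N -> I m = I k.

Definition artinian_module : Prop :=
  forall I : nat -> set M,
    (forall k, submodule (I k)) -> (forall k, I k.+1 `<=` I k) ->
    exists k, forall m, (k <= m)%N -> I m = I k.

End Modules.

Section Rings.
Variable A : nzRingType.

(* MathComp modules are left modules.  The left module of [A] over itself is   *)
(* [A^o]; the right module is [A^c^o], a left module over the converse ring    *)
(* [A^c], in which [a *: x] is the product [x * a] of [A].                     *)
Definition left_module : lmodType A := A^o.
Definition right_module : lmodType A^c := (A^c)^o.

Definition right_distributive_ring : Prop := distributive_module right_module.
Definition right_noetherian_ring : Prop := noetherian_module right_module.

Definition distributive_ring : Prop :=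
  distributive_module right_module /\ distributive_module left_module.
Definition uniserial_ring : Prop :=
  uniserial_module right_module /\ uniserial_module left_module.
Definition noetherian_ring : Prop :=
  noetherian_module right_module /\ noetherian_module left_module.
Definition artinian_ring : Prop :=
  artinian_module right_module /\ artinian_module left_module.

Definition ring_center : set A := [set c | forall x, GRing.comm c x].

Definition centrally_essential : Prop :=
  forall a : A, a != 0 ->
    exists c d : A,
      [/\ ring_center c, ring_center d, c != 0, d != 0 & a * c = d].

End Rings.

Section Dedekind.
Variable D : idomainType.

(* [idealr_closed] includes properness. *)
Definition prime_ideal (P : set D) : Prop :=
  idealr_closed [in P] /\ prime_idealr_closed [in P].

Definition maximal_ideal (P : set D) : Prop :=
  idealr_closed [in P] /\
  forall J : set D, idealr_closed [in J] -> P `<=` J -> J = P.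

Definition integrally_closed : Prop :=
  forall u : {fraction D}, integralOver (@tofrac D) u ->
    exists a : D, u = tofrac a.

(* Fields are allowed: they have no nonzero prime ideal. *)
Definition dedekind : Prop :=
  [/\ noetherian_ring D,
      integrally_closed &
      forall P : set D, prime_ideal P -> P <> [set 0] -> maximal_ideal P].

End Dedekind.

(* Being a commutative domain is extra structure ([idomainType]) in MathComp,  *)
(* so for a bare ring it is expressed up to isomorphism.                       *)
Definition commutative_dedekind_domain (A : nzRingType) : Prop :=
  exists (D : idomainType) (f : {rmorphism A -> D}), bijective f /\ dedekind D.

(* [A] is isomorphic to the product of the [B i]: the map to the dependent     *)
(* product with components [f i] is a ring morphism for the componentwise      *)
(* operations exactly when each [f i] is one.                                  *)
Definition is_product (A : nzRingType) (n : nat) (B : 'I_n -> nzRingType) :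
    Prop :=
  exists f : forall i : 'I_n, {rmorphism A -> B i},
    bijective (fun (a : A) (i : 'I_n) => f i a).

(* Main.v *)
Require Import Defs.
From HB Require Import structures.
From mathcomp Require Import all_boot all_algebra ring.
From mathcomp Require Import boolp classical_sets.

Set Implicit Arguments.
Unset Strict Implicit.
Unset Printing Implicit Defensive.

Import GRing.Theory.
Local Open Scope classical_set_scope.
Local Open Scope ring_scope.

(** Right distributivity has an elementwise form, the splitting condition: for
    all [a], [b] some [x] has [a x] in [b A] and [b (1 - x)] in [a A]
    ([right_distributiveP]).  It passes to homomorphic images and to products,
    as does the ascending chain condition, and it is what every argument below
    works with.  Left-handed statements are right-handed statements about the
    converse ring [A^c].

    From the ring to its factors.  Idempotents of a centrally essential ring
    are central ([central_idempotent]), so the ascending chain condition cuts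
    [A] into finitely many corners [e A] with [e] a primitive idempotent
    ([primitive_decomposition], [corner_is_product]).  In such an indecomposable
    ring [R] every element is nilpotent or regular ([nilpotent_or_regular]):
    some power [z] of it has the same right annihilator as [z ^+ 2], and such
    an annihilator is generated by an idempotent ([right_ann_idempotent]).

    If [R] has no zero divisors, central essentiality makes it commutative, and
    a commutative Noetherian domain with splitting is Dedekind: splitting
    clears the denominator of an integral fraction
    ([splitting_integrally_closed]), and a nonzero prime below a larger proper
    ideal would produce an infinite ascending chain
    ([splitting_prime_maximal]).

    If [R] has zero divisors, it contains a central [f != 0] of square zero.
    Splitting makes [f] divisible by every power of a regular [d], and the
    ascending chain condition turns this into invertibility of [d]
    ([nilpotent_or_invertible]).  Hence [R] is local with nilpotent non-units,
    and splitting becomes comparability of right ideals.  The non-units form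
    [p R] with [p] nilpotent, which bounds descending chains.  For the left
    side, the least nonzero right ideal is also the least nonzero left ideal,
    since it is generated by a central element ([two_sided_socle]); this
    forces [a R] into [R a] ([principal_left_multiple]), so left ideals are
    comparable too.

    From the factors to the ring.  Comparability trivially implies splitting,
    and for a uniserial ring the descending chain condition on one side gives
    the ascending one on the other ([left_dcc_right_acc]).  In a Dedekind
    domain the ideal of all [x + y] with [b | a x] and [a | b y] lies in no
    maximal ideal [P], because up to factors outside [P] every nonzero element
    is a power of one and the same element ([local_valuation]).  All these
    facts hold on both sides, which also gives the final claim. *)

(** * Right ideals and the elementwise forms of the module conditions *)
Section RightIdeals.
Variable R : nzRingType.
Implicit Types (a b c d e x y z : R) (I J K : set R).

Definition right_ideal I : Prop :=
  I 0 /\ forall a u v, I u -> I v -> I (u * a + v).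
Definition principal a : set R := [set x | exists r, x = a * r].
Definition right_ann a : set R := [set x | a * x = 0].

Definition right_acc : Prop :=
  forall I : nat -> set R,
    (forall k, right_ideal (I k)) -> (forall k, I k `<=` I k.+1) ->
    exists k, forall m, (k <= m)%N -> I m = I k.
Definition right_dcc : Prop :=
  forall I : nat -> set R,
    (forall k, right_ideal (I k)) -> (forall k, I k.+1 `<=` I k) ->
    exists k, forall m, (k <= m)%N -> I m = I k.
(** The elementwise form of right distributivity; in a local ring one of [x],
    [1 - x] is invertible, so it says that principal right ideals compare. *)
Definition right_splitting : Prop :=
  forall a b, exists x, principal b (a * x) /\ principal a (b * (1 - x)).
Definition right_chain : Prop :=
  forall a b, principal a b \/ principal b a.

Lemma right_idealM I a x : right_ideal I -> I x -> I (x * a).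
Proof. by case=> I0 IP Ix; rewrite -[_ * _]addr0; apply: IP. Qed.

Lemma right_idealD I x y : right_ideal I -> I x -> I y -> I (x + y).
Proof. by case=> I0 IP Ix Iy; rewrite -[x]mulr1; apply: IP. Qed.

Lemma right_idealB I x y : right_ideal I -> I x -> I y -> I (x - y).
Proof.
by move=> rI Ix Iy; apply: right_idealD => //; rewrite -mulrN1; apply: right_idealM.
Qed.

Lemma right_ideal_principal a : right_ideal (principal a).
Proof.
split; first by exists 0; rewrite mulr0.
by move=> b _ _ [r ->] [s ->]; exists (r * b + s); rewrite mulrDr mulrA.
Qed.

Lemma right_ideal_ann a : right_ideal (right_ann a).
Proof.
split; first exact: mulr0.
by move=> b u v; rewrite /right_ann /= => au av; rewrite mulrDr mulrA au mul0r av addr0.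
Qed.

Lemma chain_le (I : nat -> set R) (k m : nat) :
  (forall k, I k `<=` I k.+1) -> (k <= m)%N -> I k `<=` I m.
Proof.
move=> inc /subnK <-; elim: (m - k)%N => [//|n IHn].
by apply: subset_trans IHn (inc _).
Qed.

(** Chain conditions are consumed through an indexed family rather than a set of
    right ideals, so that the extremal ideal comes with the data, such as an
    element or an exponent, from which it was built. *)
Lemma right_acc_max (T : Type) (P : T -> Prop) (phi : T -> set R) (t0 : T) :
  right_acc -> (forall t, P t -> right_ideal (phi t)) -> P t0 ->
  exists2 t, P t & forall t', P t' -> phi t `<=` phi t' -> phi t' `<=` phi t.
Proof.
move=> accR ideal_phi Pt0; apply: contrapT => nomax.
have /choice [f fP] : forall t, exists t',
    P t -> [/\ P t', phi t `<=` phi t' & ~ phi t' `<=` phi t].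
  move=> t; apply: contrapT => /forallNP not_t; apply: nomax; exists t.
    by have /not_implyP [] := not_t t.
  move=> t' Pt' le_tt'; apply: contrapT => nle; apply: (not_t t') => _.
  by split.
pose g k := iter k f t0.
have Pg k : P (g k) by elim: k => //= k /fP [].
have [k /(_ k.+1 (leqnSn k)) eqk] :=
  accR (phi \o g) (fun k => ideal_phi _ (Pg k))
       (fun k => let: And3 _ h _ := fP _ (Pg k) in h).
have [_ _] := fP _ (Pg k); apply.
by move: eqk => /= ->.
Qed.

Lemma right_dcc_min (T : Type) (P : T -> Prop) (phi : T -> set R) (t0 : T) :
  right_dcc -> (forall t, P t -> right_ideal (phi t)) -> P t0 ->
  exists2 t, P t & forall t', P t' -> phi t' `<=` phi t -> phi t `<=` phi t'.
Proof.
move=> dccR ideal_phi Pt0; apply: contrapT => nomin.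
have /choice [f fP] : forall t, exists t',
    P t -> [/\ P t', phi t' `<=` phi t & ~ phi t `<=` phi t'].
  move=> t; apply: contrapT => /forallNP not_t; apply: nomin; exists t.
    by have /not_implyP [] := not_t t.
  move=> t' Pt' le_tt'; apply: contrapT => nle; apply: (not_t t') => _.
  by split.
pose g k := iter k f t0.
have Pg k : P (g k) by elim: k => //= k /fP [].
have [k /(_ k.+1 (leqnSn k)) eqk] :=
  dccR (phi \o g) (fun k => ideal_phi _ (Pg k))
       (fun k => let: And3 _ h _ := fP _ (Pg k) in h).
have [_ _] := fP _ (Pg k); apply.
by move: eqk => /= ->.
Qed.

Lemma right_ideal_submodule I : submodule (M := right_module R) I <-> right_ideal I.
Proof.
split=> [[I0 IP]|[I0 IP]]; split.
- by move: I0; rewrite in_setE.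
- move=> a u v Iu Iv.
  by have := IP a u v; rewrite !in_setE; apply.
- by rewrite in_setE.
- by move=> a u v; rewrite !in_setE; apply: IP.
Qed.

(** With [j u] in [k R] and [k (1 - u)] in [j R], both summands of
    [(j + k) (1 - u)] lie in [J] and both summands of [(j + k) u] lie in [K]. *)
Lemma right_splitting_capD I J K j k : right_splitting ->
  right_ideal I -> right_ideal J -> right_ideal K ->
  J j -> K k -> I (j + k) ->
  exists2 y, I y /\ J y & exists2 z, I z /\ K z & y + z = j + k.
Proof.
move=> split_R rI rJ rK Jj Kk Ijk.
have [u [[r jr] [s ks]]] := split_R j k.
have J1 : J ((j + k) * (1 - u)).
  by rewrite mulrDl ks; apply: right_idealD => //; apply: right_idealM.
have K1 : K ((j + k) * u).
  by rewrite mulrDl jr; apply: right_idealD => //; apply: right_idealM.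
exists ((j + k) * (1 - u)); first by split=> //; apply: right_idealM.
exists ((j + k) * u); first by split=> //; apply: right_idealM.
by rewrite -mulrDr subrK mulr1.
Qed.

(** For the forward direction, distributivity is applied to
    [a R] inside [b R + (a - b) R]: if [a = x + (a - b) s] with [x] and
    [(a - b) s] in [a R], then [b s] is in [a R] and [a (1 - s)] in [b R]. *)
Lemma right_distributiveP : distributive_module (right_module R) <-> right_splitting.
Proof.
split=> [dist a b | split_R I J K /right_ideal_submodule rI
    /right_ideal_submodule rJ /right_ideal_submodule rK].
- have sub c : submodule (M := right_module R) (principal c).
    exact/right_ideal_submodule/right_ideal_principal.
  have : (principal a `&` sum_submodule (M := right_module R) (principal b)
           (principal (a - b))) a.
    split; first by exists 1; rewrite mulr1.
    by exists b; [exists 1; rewrite mulr1|exists (a - b); [exists 1; rewrite mulr1|exact: subrKC]].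
  rewrite dist //.
  case=> x [_ [r xb]] [y [[u ya] [s yab]] def_a].
  exists (1 - s); split.
    by exists (r - s); rewrite !mulrBr mulr1 -{1}def_a xb yab mulrBl -addrA addrAC subrr sub0r.
  by exists (s - u); rewrite subKr mulrBr -ya yab mulrBl subKr.
- apply/seteqP; split=> [x [Ix [j Jj [k Kk def_x]]] | x [y [Iy Jy] [z [Iz Kz] <-]]].
    rewrite -def_x in Ix *.
    exact: (right_splitting_capD split_R rI rJ rK).
  by split; [exact: right_idealD|exists y => //; exists z].
Qed.

Lemma right_noetherianP : noetherian_module (right_module R) <-> right_acc.
Proof.
by split=> accR I rI; apply: accR => k; apply/right_ideal_submodule.
Qed.

Lemma right_artinianP : artinian_module (right_module R) <-> right_dcc.
Proof.
by split=> accR I rI; apply: accR => k; apply/right_ideal_submodule.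
Qed.

Lemma right_uniserialP : uniserial_module (right_module R) <-> right_chain.
Proof.
split=> [uR a b | chain I J /right_ideal_submodule rI /right_ideal_submodule rJ].
  have sub c : submodule (M := right_module R) (principal c).
    exact/right_ideal_submodule/right_ideal_principal.
  by case: (uR _ _ (sub a) (sub b)) => [/(_ a)|/(_ b)] h; [right|left];
    apply: h; exists 1; rewrite mulr1.
have [|/existsNP [x /not_implyP [Ix nJx]]] := pselect (I `<=` J); first by left.
right=> y Jy; case: (chain x y) => [[r ->]|[r def_x]]; first exact: right_idealM.
by case: nJx; rewrite def_x; apply: right_idealM.
Qed.

End RightIdeals.

Section LeftModules.
Variable R : nzRingType.

Lemma left_ideal_submodule (I : set R) :
  submodule (M := left_module R) I <-> @right_ideal R^c I.
Proof.
split=> [[I0 IP]|[I0 IP]]; split.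
- by move: I0; rewrite in_setE.
- move=> a u v Iu Iv.
  by have := IP a u v; rewrite !in_setE; apply.
- by rewrite in_setE.
- by move=> a u v; rewrite !in_setE; apply: IP.
Qed.

Lemma left_distributiveP : distributive_module (left_module R) <-> right_splitting R^c.
Proof.
rewrite -right_distributiveP.
split=> dist I J K sI sJ sK; apply: dist;
  exact/left_ideal_submodule/(right_ideal_submodule (R := R^c)).
Qed.
Lemma left_noetherianP : noetherian_module (left_module R) <-> right_acc R^c.
Proof.
by split=> accR I rI; apply: accR => k; apply/left_ideal_submodule.
Qed.

Lemma left_artinianP : artinian_module (left_module R) <-> right_dcc R^c.
Proof.
by split=> accR I rI; apply: accR => k; apply/left_ideal_submodule.
Qed.

Lemma left_uniserialP : uniserial_module (left_module R) <-> right_chain R^c.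
Proof.
rewrite -right_uniserialP.
split=> dist I J sI sJ; apply: dist;
  exact/left_ideal_submodule/(right_ideal_submodule (R := R^c)).
Qed.
End LeftModules.

(** * Centrally essential rings *)
Section CentrallyEssential.
Variable R : nzRingType.
Hypothesis ceR : centrally_essential R.
Implicit Types (a b c d e x y z : R).

Lemma ce_multiple a : a != 0 ->
  exists c, [/\ ring_center c, ring_center (a * c) & a * c != 0].
Proof. by move=> /ceR [c [d [cc cd _ d0 ac]]]; exists c; rewrite ac. Qed.

Lemma central_idempotent e : e * e = e -> ring_center e.
Proof.
move=> ee.
have peirce0 f g x : f * f = f -> g * f = 0 -> f * x * g = 0.
  move=> ff gf; apply/eqP/negPn/negP => /ce_multiple [c [cc cd]] /negP; apply.
  (* d = f x g c is central and d = f d, hence d = d f = f x g f c = 0 *)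
  have -> : f * x * g * c = f * (f * x * g * c) by rewrite !mulrA ff.
  by rewrite -cd -!mulrA cc !mulrA -(mulrA _ g f) gf mulr0 mul0r.
have e1e : (1 - e) * e = 0 by rewrite mulrBl mul1r ee subrr.
have ee1 : e * (1 - e) = 0 by rewrite mulrBr mulr1 ee subrr.
have e1 : (1 - e) * (1 - e) = 1 - e by rewrite mulrBl mul1r ee1 subr0.
move=> x; rewrite /GRing.comm.
have /eqP := peirce0 e (1 - e) x ee e1e.
have /eqP := peirce0 (1 - e) e x e1 ee1.
rewrite mulrBl mul1r mulrBl subr_eq0 => /eqP ->.
by rewrite mulrBr mulr1 subr_eq0 => /eqP.
Qed.

(** The idempotent [b a] is central, hence
    [1 = (a b) (a b) = a (b a) b = (b a) a b = b a]. *)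
Lemma ce_dedekind_finite a b : a * b = 1 -> b * a = 1.
Proof.
move=> ab.
have /central_idempotent baC : (b * a) * (b * a) = b * a.
  by rewrite mulrA -(mulrA b) ab mulr1.
have : b * a * a * b = 1 by rewrite baC -!mulrA ab mulr1 ab.
by rewrite -mulrA ab mulr1.
Qed.

Lemma right_annihilator_central a b : a * b = 0 -> b != 0 ->
  exists d, [/\ ring_center d, d != 0 & a * d = 0].
Proof.
move=> ab /ce_multiple [c [_ cd d0]]; exists (b * c).
by split; rewrite // mulrA ab mul0r.
Qed.

Lemma left_annihilator_central a b : a * b = 0 -> a != 0 ->
  exists d, [/\ ring_center d, d != 0 & b * d = 0].
Proof.
move=> ab /ce_multiple [c [cc cd d0]]; exists (a * c).
by split; rewrite // -cd -mulrA cc mulrA ab mul0r.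
Qed.

(** If [c] and [a c] are central then [(a b - b a) c = 0], because
    [a b c = a c b = b a c]. *)
Lemma ce_domain_comm : (forall a b, a * b = 0 -> a = 0 \/ b = 0) ->
  forall a b, a * b = b * a.
Proof.
move=> domR a b; have [->|/ce_multiple [c [cc cd d0]]] := eqVneq a 0.
  by rewrite mul0r mulr0.
have : (a * b - b * a) * c = 0.
  by rewrite mulrBl -mulrA -cc mulrA cd mulrA subrr.
by case/domR=> [/eqP|c0]; [rewrite subr_eq0 => /eqP|rewrite c0 mulr0 eqxx in d0].
Qed.

Lemma centrally_essential_converse : centrally_essential R^c.
Proof.
move=> a /ceR [c [d [cc cd c0 d0 ac]]]; exists c, d; split => //.
- by move=> x; exact: esym (cc x).
- by move=> x; exact: esym (cd x).
- exact: etrans (cc a) ac.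
Qed.

(** Let [K] be the right annihilator of [z].  Splitting for [z] and [k] in [K]
    gives [y] in [K] with [k y = k].  Among the elements [u] of [1 + K], which
    is closed under multiplication, take one with the largest right
    annihilator.  Multiplying it by further elements of [1 + K] cannot enlarge
    that annihilator, so it contains every central element of [K] and equals
    the one of [u ^+ 2].  A nonzero [u t] with [t] in [K] would have a nonzero
    central multiple [u t c] in [K], which [u] kills; hence [u K = 0], and
    [1 - u] is the idempotent generating [K]. *)
Lemma right_ann_idempotent z :
  right_splitting R -> right_acc R ->
  (forall x, z * (z * x) = 0 -> z * x = 0) ->
  exists2 e, e * e = e & forall x, z * x = 0 <-> e * x = x.
Proof.
move=> splitR accR z2.
pose K : set R := right_ann z.
have KM x y : K x -> K (x * y) by exact: right_idealM (right_ideal_ann z).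
have KB x y : K x -> K y -> K (x - y) by exact: right_idealB (right_ideal_ann z).
have K_unit k : K k -> exists2 y, K y & k * (1 - y) = 0.
  move=> zk; have [x [[r xr] [s xs]]] := splitR z k; exists x.
    by apply: z2; rewrite xr mulrA zk mul0r.
  rewrite xs; apply: z2; by rewrite -xs mulrA zk mul0r.
have K0 : K (1 - 1) by rewrite subrr /K /right_ann /= mulr0.
have [u Ku umax] := right_acc_max (P := fun u => K (1 - u)) accR
  (fun u _ => right_ideal_ann u) K0.
have K1M v : K (1 - v) -> K (1 - v * u).
  move=> Kv; have -> : 1 - v * u = (1 - v) * u + (1 - u).
    by rewrite mulrBl mul1r [RHS]addrC addrA subrK.
  by apply: right_idealD (right_ideal_ann z) _ _ => //; apply: (KM).
have u_central d : ring_center d -> K d -> u * d = 0.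
  move=> cd /K_unit [y Ky dy].
  have Ky1 : K (1 - (1 - y)) by rewrite subKr.
  apply: (umax _ (K1M _ Ky1)).
    by move=> x ux; rewrite /right_ann /= -mulrA ux mulr0.
  by rewrite /right_ann /= -mulrA -cd mulrA -cd dy mul0r.
have u2 x : u * (u * x) = 0 -> u * x = 0.
  move=> uux; apply: (umax _ (K1M _ Ku)); last by rewrite /right_ann /= -mulrA.
  by move=> t ut; rewrite /right_ann /= -mulrA ut mulr0.
have uK t : K t -> u * t = 0.
  move=> Kt; apply/eqP/negPn/negP => /ce_multiple [c [_ cd /eqP d0]].
  apply: d0; rewrite -mulrA; apply: u2; rewrite [u * (t * c)]mulrA.
  apply: u_central => //; apply: (KM).
  have -> : u * t = t - (1 - u) * t by rewrite mulrBl mul1r subKr.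
  by apply: KB => //; apply: (KM).
exists (1 - u).
  by rewrite [LHS]mulrBl mul1r (uK _ Ku) subr0.
move=> x; split=> [zx|<-].
  by rewrite mulrBl mul1r (uK _ zx) subr0.
exact: KM.
Qed.

Lemma stable_power a : right_acc R ->
  exists n, forall x, a ^+ n.+1 * (a ^+ n.+1 * x) = 0 -> a ^+ n.+1 * x = 0.
Proof.
move=> accR.
have inc k : right_ann (a ^+ k) `<=` right_ann (a ^+ k.+1).
  by move=> x; rewrite /right_ann /= exprS -mulrA => ->; rewrite mulr0.
have [n eq_n] := accR _ (fun k => right_ideal_ann (a ^+ k)) inc.
exists n => x; rewrite mulrA -exprD => ax.
have : right_ann (a ^+ (n.+1 + n.+1)) x by [].
by rewrite eq_n ?addSn ?leqW ?leq_addr // => nx; apply: inc.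
Qed.

Definition indecomposable : Prop := forall e, e * e = e -> e = 0 \/ e = 1.

Definition nilpotent a : Prop := exists n, a ^+ n = 0.

Lemma nilpotent_or_regular a : right_splitting R -> right_acc R -> indecomposable ->
  nilpotent a \/ (forall x, a * x = 0 -> x = 0).
Proof.
move=> splitR accR indR; have [n an] := stable_power a accR.
have [e /indR [->|->] eP] := right_ann_idempotent splitR accR an.
  right=> x ax; have /eP : a ^+ n.+1 * x = 0 by rewrite exprSr -mulrA ax mulr0.
  by rewrite mul0r.
by left; exists n.+1; rewrite -[LHS]mulr1; apply/eP; rewrite mulr1.
Qed.
End CentrallyEssential.

(** * Local rings with nilpotent non-units *)
Section ChainDcc.
Variable R : nzRingType.

(** When principal right ideals compare, every element of a right ideal that
    misses [x] is [x y] with [y] not right invertible, so each strict step of a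
    descending chain moves one stage down the filtration [F]. *)
Lemma filtered_chain_dcc (F : nat -> set R) (n : nat) : right_chain R ->
  (forall a, F 0 a) -> (forall a, F n a -> a = 0) ->
  (forall m a y, F m a -> ~ (exists y', y * y' = 1) -> F m.+1 (a * y)) ->
  right_dcc R.
Proof.
move=> chainR F0 Fn FS I rI decI; apply: contrapT => /forallNP unstable.
have drop k : exists k' x, I k x /\ ~ I k' x.
  have /existsNP [m /not_implyP [le_km neq]] := unstable k.
  apply: contrapT => all_in; apply: neq; apply/seteqP; split=> x; last first.
    by move=> Ikx; apply: contrapT => nI; apply: all_in; exists m, x.
  have /subnK <- := le_km; elim: (m - k)%N => //= i IHi Ix.
  exact/IHi/decI.
have deep m : exists k, I k `<=` F m.
  elim: m => [|m [k IkF]]; first by exists 0 => a _; apply: F0.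
  have [k' [x [Ix nIx]]] := drop k; exists k' => a Ia.
  case: (chainR x a) => [[y def_a]|[y def_x]]; last first.
    by case: nIx; rewrite def_x; apply: right_idealM.
  rewrite def_a; apply: FS; first exact: IkF.
  case=> y' yy'; case: nIx.
  by rewrite -[x]mulr1 -yy' mulrA -def_a; apply: right_idealM.
have [k Ik0] := deep n; have [k' [x [Ix]]] := drop k; apply.
by rewrite (Fn x (Ik0 x Ix)); case: (rI k').
Qed.
End ChainDcc.

Section LocalRing.
Variable R : nzRingType.
Hypothesis ceR : centrally_essential R.
Implicit Types (a b c d e x y z : R).

Lemma nilpotent_not_invertible a : nilpotent a -> ~ exists b, a * b = 1.
Proof.
case=> n an [b ab]; elim: n an => [/eqP|n IHn an]; first by rewrite oner_eq0.
by apply: IHn; rewrite -[LHS]mulr1 -ab mulrA -exprSr an mul0r.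
Qed.

Lemma nilpotent_sub1_invertible z : nilpotent z -> exists w, (1 - z) * w = 1.
Proof.
case=> n zn; exists (\sum_(i < n) z ^+ i).
by apply: oppr_inj; rewrite -mulNr opprB -subrX1 zn sub0r.
Qed.

Section NonDomain.
Hypotheses (splitR : right_splitting R) (accR : right_acc R).
Hypothesis indR : indecomposable R.
Variables (a0 b0 : R).
Hypotheses (a0_neq0 : a0 != 0) (b0_neq0 : b0 != 0) (ab0 : a0 * b0 = 0).

(** Zero divisors produce a nonzero central one, which is not regular and hence
    nilpotent; its last nonzero power is [f]. *)
Lemma square_zero_central : exists f : R, [/\ ring_center f, f != 0 & f * f = 0].
Proof.
have [d [cd d0 ad]] := right_annihilator_central ceR ab0 b0_neq0.
have [[n dn]|reg] := nilpotent_or_regular ceR d splitR accR indR; last first.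
  by move: a0_neq0; rewrite (reg a0) ?eqxx // cd.
have [|m /eqP dm mmin] := @ex_minnP (fun n => d ^+ n == 0).
  by exists n; apply/eqP.
case: m => [|[|m]] in dm mmin *.
- by move/eqP: dm; rewrite oner_eq0.
- by move/eqP: dm d0; rewrite expr1 => ->.
exists (d ^+ m.+1); split.
- by move=> x; apply/commr_sym/commrX => //; apply/commr_sym.
- by apply/negP => /mmin; rewrite ltnn.
- by rewrite -exprD addSn -addnS exprD dm mulr0.
Qed.

(** Splitting for [f] and [d] gives [x] with [f x] in [d R] and
    [d (1 - x) = f s]; multiplying by [f] kills the latter, so
    [f (1 - x) = 0] by regularity of [d], that is [f] itself is in [d R]. *)
Lemma regular_dvd f d : ring_center f -> f * f = 0 ->
  (forall x, d * x = 0 -> x = 0) -> exists r, f = d * r.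
Proof.
move=> cf ff reg; have [x [[r xr] [s xs]]] := splitR f d; exists r.
suff : f * (1 - x) = 0 by rewrite -xr mulrBr mulr1 => /eqP; rewrite subr_eq0 => /eqP.
by apply: reg; rewrite mulrA -cf -mulrA xs mulrA ff mul0r.
Qed.

(** Write [f = d ^+ n * r n] for all [n].  The [r n] commute with [d], so
    [r n = r n.+1 * d] and the right ideals they generate ascend; stability
    gives [r n * (1 - a d) = 0] for some [a].  Then [1 - a d] is a zero
    divisor, hence nilpotent, and [a d] is invertible. *)
Lemma nilpotent_or_invertible d : nilpotent d \/ exists b, d * b = 1.
Proof.
have [|reg] := nilpotent_or_regular ceR d splitR accR indR; first by left.
right; have [f [cf f0 ff]] := square_zero_central.
have regX n x : d ^+ n * x = 0 -> x = 0.
  elim: n x => [|n IHn] x; first by rewrite mul1r.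
  by rewrite exprS -mulrA => /reg/IHn.
have [|[n r] /= def_f rmax] :=
  right_acc_max (P := fun nr : nat * R => f = d ^+ nr.1 * nr.2)
    (phi := fun nr => principal nr.2) (t0 := (0, f)) accR
    (fun nr _ => right_ideal_principal nr.2).
  by rewrite mul1r.
have [r' def_f'] := regular_dvd cf ff (regX n.+1).
have def_r : r = d * r'.
  apply/eqP; rewrite -subr_eq0; apply/eqP/(regX n).
  by rewrite mulrBr mulrA -exprSr -def_f -def_f' subrr.
(* d^(n+1) r' is central, so cancelling d^(n+1) makes r' commute with d *)
have dr' : d * r' = r' * d.
  apply/eqP; rewrite -subr_eq0; apply/eqP/(regX n.+1).
  by rewrite mulrBr !mulrA -exprSr exprS -def_f' -mulrA -def_f' cf subrr.
have [a r'a] : principal r r'.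
  apply: (rmax (n.+1, r') def_f'); last by exists 1; rewrite mulr1.
  by move=> _ [t ->]; exists (d * t); rewrite /= def_r dr' mulrA.
have r_ad : r * (1 - a * d) = 0.
  by rewrite mulrBr mulr1 mulrA -r'a def_r dr' subrr.
have r0 : r != 0 by apply: contraNneq f0 => r0; rewrite def_f r0 mulr0.
have [t [_ t0 adt]] := left_annihilator_central ceR r_ad r0.
have [nil|reg1] := nilpotent_or_regular ceR (1 - a * d) splitR accR indR.
  have [w] := nilpotent_sub1_invertible nil.
  rewrite subKr => /(ce_dedekind_finite ceR).
  by rewrite mulrA => /(ce_dedekind_finite ceR) dw; exists (w * a).
by move: t0; rewrite (reg1 t) ?eqxx.
Qed.

Lemma local_right_chain : right_chain R.
Proof.
move=> a b; have [x [[r xr] [s xs]]] := splitR a b.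
have [/nilpotent_sub1_invertible [y xy]|[y xy]] := nilpotent_or_invertible x.
  by left; exists (s * y); rewrite mulrA -xs -mulrA xy mulr1.
by right; exists (r * y); rewrite mulrA -xr -mulrA xy mulr1.
Qed.
End NonDomain.

Section ChainRing.
Hypotheses (chainR : right_chain R) (accR : right_acc R).
Hypothesis localR : forall a, nilpotent a \/ exists b, a * b = 1.

Lemma nilpotentMr a x : nilpotent a -> nilpotent (a * x).
Proof.
move=> nil_a; case: (localR (a * x)) => // [[y axy]].
by case: (nilpotent_not_invertible nil_a); exists (x * y); rewrite mulrA.
Qed.

(** If [x a] is not in [a R] then [a = x a y] with [y] nilpotent, and iterating
    [a = x ^+ k * a * y ^+ k] yields [a = 0]. *)
Lemma right_duo x a : principal a (x * a).
Proof.
case: (chainR a (x * a)) => // [[y def_a]].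
case: (localR y) => [[n yn]|[y' yy']].
  have iter_a k : a = x ^+ k * a * y ^+ k.
    elim: k => [|k IHk]; first by rewrite mul1r mulr1.
    by rewrite [LHS]def_a [in LHS]IHk exprS exprSr !mulrA.
  by exists 0; rewrite (iter_a n) yn !mulr0.
by exists y'; rewrite {2}def_a -mulrA yy' mulr1.
Qed.

(** A nilpotent element with the largest principal right ideal absorbs all the
    others by comparability. *)
Lemma nilpotent_generator : exists2 p, nilpotent p & forall a, nilpotent a -> principal p a.
Proof.
have nil0 : nilpotent (0 : R) by exists 1%N; rewrite expr1.
have [p nil_p pmax] := right_acc_max (P := @nilpotent R) (phi := fun a => principal a)
  accR (fun a _ => right_ideal_principal a) nil0.
exists p => // a nil_a; case: (chainR p a) => // [[r def_p]].
apply: (pmax a nil_a); last by exists 1; rewrite mulr1.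
by move=> _ [s ->]; exists (r * s); rewrite def_p mulrA.
Qed.

Section Generator.
Variable p : R.
Hypothesis nil_p : nilpotent p.
Hypothesis genp : forall a, nilpotent a -> principal p a.

Lemma principal_nilpotentM m a y :
  principal (p ^+ m) a -> nilpotent y -> principal (p ^+ m.+1) (a * y).
Proof.
case=> b -> nil_y; case: (right_duo b y) => b' def_b.
have [c def_c] : principal p (y * b') by apply: genp; apply: nilpotentMr.
by exists c; rewrite exprSr -!mulrA def_b def_c.
Qed.

Lemma chain_right_dcc : right_dcc R.
Proof.
have [n pn] := nil_p.
apply: (filtered_chain_dcc (F := fun m => principal (p ^+ m)) (n := n)) => //.
- by move=> a; exists a; rewrite mul1r.
- by move=> a [b ->]; rewrite pn mul0r.
move=> m a y Fa ny; apply: principal_nilpotentM => //.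
by case: (localR y).
Qed.

(** If [p ^+ m] is the last nonzero power of [p], a central multiple
    [f = p ^+ m * c] is killed by all non-units, so by comparability every
    nonzero right ideal contains it.  A nonzero left ideal contains a nonzero
    central element, hence a right ideal, hence [f]. *)
Lemma two_sided_socle : exists f : R, [/\ f != 0,
  forall a, a != 0 -> exists r, a * r = f & forall a, a != 0 -> exists r, r * a = f].
Proof.
have [|m /eqP pm mmin] := @ex_minnP (fun n => p ^+ n == 0).
  by case: nil_p => n pn; exists n; apply/eqP.
case: m => [|m] in pm mmin *; first by move/eqP: pm; rewrite oner_eq0.
have /(ce_multiple ceR) [c [cc cf f0]] : p ^+ m != 0.
  by apply/negP => /mmin; rewrite ltnn.
have f_nil y : nilpotent y -> p ^+ m * c * y = 0.
  move=> nil_y; have [|t ->] := @principal_nilpotentM m (p ^+ m * c) y _ nil_y.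
    by exists c.
  by rewrite pm mul0r.
have right_f a : a != 0 -> exists r, a * r = p ^+ m * c.
  move=> a0; case: (chainR (p ^+ m * c) a) => [[y def_a]|[r ->]]; last by exists r.
  case: (localR y) => [/f_nil fy|[y' yy']]; first by rewrite def_a fy eqxx in a0.
  by exists y'; rewrite def_a -[LHS]mulrA yy' mulr1.
exists (p ^+ m * c); split=> // a /(ce_multiple ceR) [d [cd cad /right_f [r adr]]].
by exists (r * d); rewrite -mulrA cd -cad.
Qed.

(** Approximate [e] in [a R] by multiples [w a].  If [e s = f] generates the
    socle then [a s] is nonzero, so [w a s = f] for some [w], and
    [g = e - w a] satisfies [g s = 0].  Since [e s] is nonzero, [g] is [e]
    times a non-unit, hence deeper in the filtration by the powers of [p];
    after finitely many corrections the error vanishes. *)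
Lemma principal_left_multiple a e : principal a e -> exists w, e = w * a.
Proof.
have [f [f0 right_f left_f]] := two_sided_socle.
have [n pn] := nil_p.
suff deep k m : (m + k = n)%N -> forall e, principal (p ^+ m) e -> principal a e ->
    exists w, e = w * a.
  by apply: (deep n 0%N) => //; exists e; rewrite mul1r.
elim: k m => [|k IHk] m.
  rewrite addn0 => -> {}e [b ->] _; exists 0.
  by rewrite pn !mul0r.
rewrite addnS -addSn => /IHk {}IHk {}e pm_e [t def_e].
have [->|e0] := eqVneq e 0; first by exists 0; rewrite mul0r.
have [s es] := right_f e e0.
have [t' ts] := right_duo t s.
have as0 : a * s != 0.
  by apply: contraNneq f0 => as0; rewrite -es def_e -mulrA ts mulrA as0 mul0r.
have [w was] := left_f _ as0.
have gs : (e - w * a) * s = 0 by rewrite mulrBl es -mulrA was subrr.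
have kill_s y : (e - w * a) * y * s = 0.
  by have [y' ys] := right_duo y s; rewrite -mulrA ys mulrA gs mul0r.
have [y def_g nil_y] : exists2 y, e - w * a = e * y & nilpotent y.
  case: (chainR e (e - w * a)) => [[y def_g]|[y def_e']]; last first.
    by move: f0; rewrite -es def_e' kill_s eqxx.
  exists y => //; case: (localR y) => // [[y' yy']].
  by move: f0; rewrite -es -[e]mulr1 -yy' mulrA -def_g kill_s eqxx.
have [w' def_w'] : exists w', e - w * a = w' * a.
  apply: IHk; first by rewrite def_g; apply: principal_nilpotentM.
  apply: right_idealB; first exact: right_ideal_principal.
    by exists t.
  exact: right_duo.
by exists (w' + w); rewrite mulrDl -def_w' subrK.
Qed.

Lemma chain_left_chain : right_chain R^c.
Proof.
move=> a b; case: (chainR b a) => /principal_left_multiple [w def_w].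
  by right; exists w.
by left; exists w.
Qed.

Lemma chain_left_dcc : right_dcc R^c.
Proof.
have [n pn] := nil_p.
apply: (filtered_chain_dcc (R := R^c)
  (F := fun m => [set a : R | exists b : R, a = b * p ^+ m]) (n := n)).
- exact: chain_left_chain.
- by move=> a; exists a; rewrite mulr1.
- by move=> a [b ->]; rewrite pn mulr0.
move=> m _ y [b ->] ny.
have nil_y : nilpotent (y : R).
  case: (localR y) => // [[y' /(ce_dedekind_finite ceR) yy']].
  by case: ny; exists y'.
have [w def_w] : exists w : R, (y : R) * b = w * p.
  exact/principal_left_multiple/genp/nilpotentMr.
exists w; change ((y : R) * (b * p ^+ m) = w * p ^+ m.+1).
by rewrite exprS mulrA def_w mulrA.
Qed.
End Generator.

Lemma local_chain_uniserial_artinian :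
  [/\ right_chain R^c, right_dcc R & right_dcc R^c].
Proof.
have [p nil_p genp] := nilpotent_generator.
by split; [exact: (chain_left_chain nil_p)|exact: (chain_right_dcc nil_p)|exact: (chain_left_dcc nil_p)].
Qed.
End ChainRing.
End LocalRing.

(** * Uniserial Artinian rings are distributive and Noetherian *)
Lemma right_chain_splitting (R : nzRingType) : right_chain R -> right_splitting R.
Proof.
move=> chainR a b; case: (chainR a b) => [[r ->]|[r ->]].
  by exists 0; split; [exists 0; rewrite !mulr0|exists r; rewrite subr0 mulr1].
by exists 1; split; [exists r; rewrite mulr1|exists 0; rewrite subrr !mulr0].
Qed.

(** Suppose right ideals [I k] ascend without stabilising and let [a0] be a
    nonzero element of their union.  Among the factorisations [a0 = b x] with
    [b] in the union take one with [R x] smallest.  As [b = b' r] for some [b']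
    further up the chain, [r] is not invertible and [a0 = b' (r x)];
    minimality gives [x = s r x], and cancelling [1 - s r] makes [x] vanish. *)
Lemma left_dcc_right_acc (R : nzRingType) : centrally_essential R ->
  right_chain R -> right_chain R^c -> right_dcc R^c -> right_acc R.
Proof.
move=> ceR chainR chainRc dccRc I rI incI; apply: contrapT => /forallNP unstable.
have grow k : exists m x, I m x /\ ~ I k x.
  have /existsNP [m /not_implyP [le_km neq]] := unstable k.
  apply: contrapT => all_in; apply: neq; apply/seteqP; split=> x; last first.
    exact: chain_le.
  by move=> Imx; apply: contrapT => nI; apply: all_in; exists m, x.
have [k0 [a0 [Ia0 nIa0]]] := grow 0.
have [|x [b [k Ib] bx] xmin] := @right_dcc_min R^c R
    (fun x => exists2 b : R, exists k, I k b & b * x = a0)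
    (fun x => @principal R^c x) 1 dccRc (fun x _ => @right_ideal_principal R^c x).
  by exists a0; [exists k0|rewrite mulr1].
have [m [b' [Ib' nIb']]] := grow k.
case: (chainR b b') => [[r def_b']|[r def_b]].
  by apply: nIb'; rewrite def_b'; apply: right_idealM.
have nr t : t * r != 1.
  apply/negP => /eqP /(ce_dedekind_finite ceR) rt; apply: nIb'.
  by rewrite -[b']mulr1 -rt mulrA -def_b; apply: right_idealM.
have [s def_x] : exists s, x = s * (r * x).
  apply: (xmin (r * x)).
  - by exists b'; [exists m|rewrite mulrA -def_b].
  - by move=> _ [t ->]; exists ((t : R) * r : R); exact: (mulrA (t : R) r x).
  - by exists 1; exact: (esym (mul1r x)).
have x0 : (1 - s * r) * x = 0 by rewrite mulrBl mul1r -mulrA -def_x subrr.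
have {}x0 : x = 0.
  case: (chainRc r (1 - s * r)) => [[t def_t]|[t def_r]].
    have {}def_t : 1 - s * r = (t : R) * r by exact: def_t.
    by have := nr ((t : R) + s); rewrite mulrDl -def_t subrK eqxx.
  have {}def_r : r = (t : R) * (1 - s * r) by exact: def_r.
  rewrite -[x]mul1r -[1](subrK (s * r)) {2}def_r.
  by rewrite mulrDl x0 add0r -!mulrA x0 !mulr0.
by apply: nIa0; rewrite -bx x0 mulr0; case: (rI 0%N).
Qed.

(** * Commutative Noetherian domains with splitting are Dedekind *)
Section DomainIdeals.
Variable D : idomainType.
Implicit Types (a b c s t x y z : D) (P J : set D).
Local Notation "x %:F" := (tofrac x).

Lemma proper_idealP J :
  idealr_closed [in J] <-> right_ideal J /\ ~ J 1.
Proof.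
split=> [[J0 J1 JP]|[[J0 JP] J1]]; split.
- split; first by move: J0; rewrite in_setE.
  by move=> a u v Ju Jv; have := JP a u v; rewrite !in_setE mulrC; apply.
- by move: J1; rewrite notin_setE.
- by rewrite in_setE.
- by rewrite notin_setE.
- by move=> a u v; rewrite !in_setE mulrC; apply: JP.
Qed.

Lemma prime_idealM P x y : prime_ideal P -> P (x * y) -> P x \/ P y.
Proof.
case=> _ primeP Pxy; have := primeP x y; rewrite !in_setE => /(_ Pxy) /orP.
by rewrite !in_setE.
Qed.

Lemma frac_fraction (u : {fraction D}) : exists a b, b != 0 /\ u * b%:F = a%:F.
Proof.
elim/quotW: u => x; exists x.1, x.2; split; first exact: denom_ratioP.
apply/eqP; unlock tofrac; rewrite -[X in X == _]FracField.pi_mul.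
rewrite FracField.equivf_def /FracField.mulf.
by rewrite !numden_Ratio ?mulf_neq0 ?oner_eq0 ?denom_ratioP // !mulr1 mulrC.
Qed.

Section PruferNoetherian.
Hypotheses (splitD : right_splitting D) (accD : right_acc D).

(** For [u = a / b], splitting yields [x] and [s] such that [u x] lies in [D] and
    [u s = 1 - x].  Multiplying a monic equation of degree [m.+1] for [u] by
    [s ^+ m] shows [u (1 - x) ^+ m] in [D]; together with [u x] in [D] this
    lowers the exponent of [1 - x] down to zero. *)
Lemma splitting_integrally_closed : integrally_closed D.
Proof.
move=> u [p p_monic /rootP pu].
have [a [b [b0 ub]]] := frac_fraction u.
have bF : b%:F != 0 by rewrite tofrac_eq0.
have [x [[r xr] [s xs]]] := splitD a b.
have ux : u * x%:F = r%:F.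
  by apply: (mulIf bF); rewrite mulrAC ub -!rmorphM xr mulrC.
have us : u * s%:F = (1 - x)%:F.
  by apply: (mulIf bF); rewrite mulrAC ub -!rmorphM -xs mulrC.
have step k : (exists d, u * ((1 - x) ^+ k)%:F = d%:F) -> exists d, u = d%:F.
  elim: k => [|k IHk] [d]; first by rewrite expr0 rmorph1 mulr1; exists d.
  move=> ud; apply: IHk; exists (d + r * (1 - x) ^+ k).
  rewrite tofracD -ud exprS !tofracM -ux tofracB tofrac1; ring.
have [m sz_p] : exists m, size p = m.+2.
  case sz_p : (size p) => [|[|m]]; last by exists m.
    by move/eqP: sz_p p_monic; rewrite size_poly_eq0 => /eqP ->; rewrite monicE lead_coef0 eq_sym oner_eq0.
  have /eqP/size_poly1P [c c0 def_p] : size p = 1%N by [].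
  by move: pu; rewrite def_p map_polyC hornerC => /eqP; rewrite tofrac_eq0 (negPf c0).
apply: (step m); exists (- \sum_(i < m.+1) p`_i * (1 - x) ^+ i * s ^+ (m - i)).
have : (map_poly (@tofrac D) p).[u] * s%:F ^+ m = 0 by rewrite pu mul0r.
rewrite horner_coef size_map_inj_poly ?rmorph0 //; last first.
  by move=> y z /eqP; rewrite tofrac_eq => /eqP.
rewrite sz_p big_ord_recr /= coef_map /= mulrDl addrC => /eqP.
have -> : p`_m.+1 = 1 by move/monicP: p_monic; rewrite lead_coefE sz_p.
rewrite addr_eq0 rmorph1 mul1r exprS -mulrA -exprMn us -rmorphXn => /eqP ->.
rewrite rmorphN rmorph_sum /= big_distrl /=; congr (- _).
apply: eq_bigr => i _; rewrite coef_map /= !rmorphM !rmorphXn /= -us.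
have le_im : (i <= m)%N by rewrite -ltnS.
have -> : s%:F ^+ m = s%:F ^+ i * s%:F ^+ (m - i) by rewrite -exprD subnKC.
by rewrite exprMn; ring.
Qed.

(** Suppose [q] is in a proper ideal [J] above [P] but not in [P].  Splitting for
    [p] in [P] and [q] gives [p x = q p'] with [p'] in [P] and [1 - x] in [P],
    so [p'] generates a larger ideal than [p] after inverting the elements of
    [1 + J].  At a maximal one, [p'] is a multiple of [p] there; cancelling [p]
    puts an element of [1 + J] into [q D], hence [1] into [J]. *)
Lemma splitting_prime_maximal P : prime_ideal P -> P <> [set 0] -> maximal_ideal P.
Proof.
move=> primeP P0; have idealP := primeP.1; split=> // J /proper_idealP [rJ J1] sPJ.
have /proper_idealP [rP P1] := idealP.
apply/seteqP; split=> // q Jq; apply: contrapT => nPq; apply: J1.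
have next p : P p -> exists x p', [/\ p * x = q * p', P p' & P (1 - x)].
  move=> Pp; have [x [[p' xp'] [t xt]]] := splitD p q; exists x, p'.
  have P1x : P (1 - x).
    have : P (q * (1 - x)) by rewrite xt; apply: right_idealM.
    by case/(prime_idealM primeP).
  split=> //; have : P (q * p') by rewrite -xp'; apply: right_idealM.
  by case/(prime_idealM primeP).
have [p0 [Pp0 p0n]] : exists p0, P p0 /\ p0 != 0.
  apply: contrapT => no_p; apply: P0; apply/seteqP; split=> x /=; last first.
    by move=> ->; case: rP.
  by move=> Px; apply/eqP; apply: contrapT => /negP x0; apply: no_p; exists x.
pose phi p : set D := [set a | exists2 s, J (1 - s) & principal p (a * s)].
have JM s t : J (1 - s) -> J (1 - t) -> J (1 - s * t).
  move=> Js Jt; have -> : 1 - s * t = (1 - s) + (1 - t) * s by ring.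
  by apply: right_idealD => //; apply: right_idealM.
have r_phi p : right_ideal (phi p).
  split; first by exists 1; [rewrite subrr; case: rJ|exists 0; rewrite mul0r mulr0].
  move=> a u v [s Js [y us]] [t Jt [z vt]]; exists (s * t); first exact: JM.
  exists (y * a * t + z * s).
  have -> : (u * a + v) * (s * t) = u * s * a * t + v * t * s by ring.
  by rewrite us vt; ring.
have [p [Pp pn] pmax] := right_acc_max (P := fun p => P p /\ p != 0) accD
  (fun p _ => r_phi p) (conj Pp0 p0n).
have [x [p' [xp' Pp' P1x]]] := next p Pp.
have Jx : J (1 - x) by apply: sPJ.
have [y0|xn] := eqVneq x 0; first by move: Jx; rewrite y0 subr0.
have p'n : p' != 0.
  by apply: contraNneq (mulf_neq0 pn xn) => p'0; rewrite xp' p'0 mulr0.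
have [s Js [t p's]] : phi p p'.
  apply: (pmax p' (conj Pp' p'n)); last first.
    by exists 1; [rewrite subrr; case: rJ|exists 1].
  move=> a [s Js [t ast]]; exists (s * x); first exact: JM.
  by exists (q * t); rewrite mulrA ast mulrAC xp'; ring.
have xs : x * s = q * t.
  by apply: (mulfI pn); rewrite mulrA xp' -mulrA p's; ring.
have -> : 1 = (1 - x * s) + q * t by rewrite xs subrK.
by apply: right_idealD => //; [apply: JM|apply: right_idealM].
Qed.
End PruferNoetherian.
End DomainIdeals.

(** * Dedekind domains satisfy splitting *)
Section DedekindSplitting.
Variable D : idomainType.
Hypotheses (accD : right_acc D) (intD : integrally_closed D).
Hypothesis dim1 : forall P : set D, prime_ideal P -> P <> [set 0] -> maximal_ideal P.
Implicit Types (a b c s t x y z : D) (P J : set D).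
Local Notation "x %:F" := (tofrac x).

Lemma exists_maximal_ideal J : right_ideal J -> ~ J 1 ->
  exists2 P, maximal_ideal P & J `<=` P.
Proof.
move=> rJ J1.
have [P [rP P1 sJP] Pmax] :=
  right_acc_max (P := fun P : set D => [/\ right_ideal P, ~ P 1 & J `<=` P])
    (phi := id) (t0 := J) accD (fun P h => let: And3 r _ _ := h in r)
    (And3 rJ J1 (fun _ => id)).
exists P => //; split; first exact/proper_idealP.
move=> Q /proper_idealP [rQ Q1] sPQ; apply/seteqP; split=> //.
by apply: Pmax => //; split=> //; apply: subset_trans sJP sPQ.
Qed.

Lemma maximal_ideal_prime P : maximal_ideal P -> prime_ideal P.
Proof.
move=> [idP maxP]; split=> // u v; rewrite !in_setE => Puv.
have /proper_idealP [rP P1] := idP.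
have [Pu|nPu] := pselect (P u); first by apply/orP; left; rewrite in_setE.
apply/orP; right; rewrite in_setE; apply: contrapT => nPv.
pose J : set D := [set x | exists2 p, P p & exists d, x = p + u * d].
have P0 : P 0 by case: rP.
have rJ : right_ideal J.
  split; first by exists 0 => //; exists 0; rewrite mulr0 addr0.
  move=> a _ _ [p Pp [d ->]] [q Pq [e ->]]; exists (p * a + q); first by case: rP => _; apply.
  by exists (d * a + e); ring.
have [[p Pp [d def1]]|J1] := pselect (J 1).
  apply: nPv; have -> : v = p * v + u * v * d by rewrite -[LHS]mul1r def1; ring.
  by apply: right_idealD => //; apply: right_idealM.
have eqJ : J = P.
  apply: maxP; first exact/proper_idealP.
  by move=> p Pp; exists p => //; exists 0; rewrite mulr0 addr0.
by apply: nPu; rewrite -eqJ; exists 0 => //; exists 1; rewrite add0r mulr1.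
Qed.

Section LocalUniformizer.
Variables (P : set D) (c : D).
Hypotheses (maxP : maximal_ideal P) (Pc : P c) (c0 : c != 0).

Let idealP : right_ideal P /\ ~ P 1 := (proper_idealP P).1 maxP.1.
Let rP : right_ideal P := idealP.1.
Let P1 : ~ P 1 := idealP.2.
Let primeP : prime_ideal P := maximal_ideal_prime maxP.

Lemma not_primeM s t : ~ P s -> ~ P t -> ~ P (s * t).
Proof. by move=> Ps Pt /(prime_idealM primeP) []. Qed.

(** The local ring at [P] has dimension one, so [P] is associated to [c D].
    Choose [phi y = (c D : y)] maximal among those that stay proper when
    localised at [P].  Maximality makes it prime and contained in [P]; being
    nonzero it is maximal, hence equal to [P]. *)
Lemma maximal_conductor : exists y, (forall t, y <> c * t) /\
  forall q, P q -> exists t, q * y = c * t.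
Proof.
(* y does not fall into c D in the localisation at P *)
pose away y := forall s t, ~ P s -> s * y <> c * t.
pose phi y : set D := [set q | exists t, q * y = c * t].
have r_phi y : right_ideal (phi y).
  split; first by exists 0; rewrite mul0r mulr0.
  by move=> a u v [t ut] [z vz]; exists (t * a + z); rewrite mulrDl mulrAC ut vz; ring.
have away1 : away 1.
  by move=> s t Ps; rewrite mulr1 => def_s; apply: Ps; rewrite def_s; apply: right_idealM.
have [y away_y ymax] := right_acc_max accD (fun y (_ : away y) => r_phi y) away1.
have phi_local s q : ~ P s -> phi y (s * q) -> phi y q.
  move=> Ps [t sqt]; apply: (ymax (s * y)).
  - by move=> s' t' Ps'; rewrite mulrA; apply: away_y; apply: not_primeM.
  - by move=> x [z xyz]; exists (s * z); rewrite mulrCA xyz; ring.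
  by exists t; rewrite -sqt; ring.
have phi1 : ~ phi y 1 by case=> t; rewrite mul1r => /esym h; case: (away_y 1 t P1); rewrite mul1r.
have phi_sub : phi y `<=` P.
  move=> q [t qy]; apply: contrapT => Pq; exact: (away_y q t Pq).
have phi_prime : prime_ideal (phi y).
  split=> [|u v]; first exact/proper_idealP.
  rewrite !in_setE => phi_uv; have [phi_u|nphi_u] := pselect (phi y u).
    by apply/orP; left; rewrite in_setE.
  apply/orP; right; rewrite in_setE; apply: (ymax (u * y)).
  - move=> s t Ps suy; apply: nphi_u; apply: (phi_local s) => //.
    by exists t; rewrite -suy; ring.
  - by move=> x [z xyz]; exists (u * z); rewrite mulrCA xyz; ring.
  by case: phi_uv => t uvt; exists t; rewrite -uvt; ring.
have phi_c : phi y c by exists y.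
have phi_n0 : phi y <> [set 0].
  by move=> phi0; move: phi_c c0; rewrite phi0 /= => ->; rewrite eqxx.
have eq_phi : P = phi y by apply: (dim1 phi_prime phi_n0).2 => //; apply: maxP.1.
exists y; split=> [t yt|q]; last by rewrite eq_phi.
by apply: phi1; exists t; rewrite mul1r.
Qed.

(** All [c u ^+ k] lie in [P], and the ideals spanned by the first [k] of them
    stabilise; this makes some [c u ^+ k] a combination of the earlier ones,
    and [c] cancels.  The ascending chain condition thus replaces the
    determinant trick. *)
Lemma stable_fraction_integral (u : {fraction D}) :
  (forall q, P q -> exists2 q', P q' & u * q%:F = q'%:F) ->
  integralOver (@tofrac D) u.
Proof.
move=> uP.
have cF : c%:F != 0 by rewrite tofrac_eq0.
have cuk k : exists z, z%:F = c%:F * u ^+ k.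
  suff [z _ zk] : exists2 z, P z & z%:F = c%:F * u ^+ k by exists z.
  elim: k => [|k [z Pz zk]]; first by exists c; rewrite // expr0 mulr1.
  by have [z' Pz' uz] := uP z Pz; exists z' => //; rewrite -uz zk exprS; ring.
pose I k : set D := [set z | exists2 q : {poly D}, (size q <= k)%N &
  z%:F = c%:F * (map_poly (@tofrac D) q).[u]].
have rI k : right_ideal (I k).
  split; first by exists 0; rewrite ?size_poly0 // tofrac0 rmorph0 horner0 mulr0.
  move=> a x y [q szq xq] [q' szq' yq]; exists (a *: q + q').
    apply: leq_trans (size_polyD _ _) _; rewrite geq_max szq' andbT.
    exact: leq_trans (size_scale_leq _ _) szq.
  rewrite tofracD tofracM xq yq rmorphD /= map_polyZ /= hornerD hornerZ; ring.
have [k stab] := accD rI (fun k z => fun '(ex_intro2 q szq zq) => ex_intro2 _ _ q (leqW szq) zq).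
have [z zk] := cuk k.
have : I k z.
  rewrite -(stab k.+1) //; exists 'X^k; first by rewrite size_polyXn.
  by rewrite map_polyXn hornerXn.
case=> q szq zq; exists ('X^k - q).
  apply/monicP; rewrite lead_coefDl ?lead_coefXn // size_polyXn size_polyN.
  by rewrite ltnS.
apply/rootP; rewrite rmorphB /= map_polyXn hornerD hornerN hornerXn.
by apply: (mulfI cF); rewrite mulr0 mulrBr -zk -zq subrr.
Qed.

(** Let [y] be as in [maximal_conductor].  The fraction [y / c] is not in [D], so
    it is not integral and cannot map [P] into itself.  As it maps [P] into
    [D], some [v] in [P] has [v y = c w] with [w] outside [P]; dividing
    [q y = c t] by this relation gives [q w = v t]. *)
Lemma local_uniformizer : exists v w, [/\ P v, ~ P w &
  forall q, P q -> exists q', q * w = v * q'].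
Proof.
have [y [y_notin yP]] := maximal_conductor.
have cF : c%:F != 0 by rewrite tofrac_eq0.
apply: contrapT => no_unif.
have stable q : P q -> exists2 t, P t & q * y = c * t.
  move=> Pq; have [w vw] := yP q Pq; exists w => //; apply: contrapT => Pw.
  apply: no_unif; exists q, w; split=> // q' /yP [t q't]; exists t.
  by apply: (mulfI c0); rewrite mulrCA -vw mulrCA q't; ring.
have [|t yt] := @intD (y%:F / c%:F).
  apply: stable_fraction_integral => q /stable [t Pt qt]; exists t => //.
  by apply: (mulfI cF); rewrite mulrA mulrCA divff // mulr1 -!tofracM mulrC qt.
apply: (y_notin t); apply/eqP; rewrite -tofrac_eq tofracM -yt.
by rewrite mulrCA divff // mulr1.
Qed.

(** As long as the cofactor [a'] lies in [P], another [v] can be split off, and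
    the local ideal generated by [a'] grows strictly; the ascending chain
    condition stops this. *)
Lemma local_valuation : exists v, forall a, a != 0 ->
  exists n s a', [/\ ~ P s, ~ P a' & a * s = v ^+ n * a'].
Proof.
have [v [w [Pv Pw vP]]] := local_uniformizer; exists v => a a0.
pose part a' := a' != 0 /\ exists n s, ~ P s /\ a * s = v ^+ n * a'.
pose phi a' : set D := [set z | exists2 s, ~ P s & principal a' (z * s)].
have r_phi a' : right_ideal (phi a').
  split; first by exists 1; rewrite // mul0r; exists 0; rewrite mulr0.
  move=> e x y [s Ps [x' xs]] [t Pt [y' yt]]; exists (s * t); first exact: not_primeM.
  exists (x' * e * t + y' * s).
  have -> : (x * e + y) * (s * t) = x * s * e * t + y * t * s by ring.
  by rewrite xs yt; ring.
have part_a : part a.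
  by split=> //; exists 0%N, 1; split=> //; rewrite expr0 mulr1 mul1r.
have [a' [a'0 [n [s [Ps as']]]] amax] :=
  right_acc_max accD (fun a' (_ : part a') => r_phi a') part_a.
exists n, s, a'; split=> // Pa'.
have [a2 a'w] := vP a' Pa'.
have w0 : w != 0.
  by apply/eqP => w0; apply: Pw; rewrite w0; case: rP.
have a20 : a2 != 0.
  by apply: contraNneq (mulf_neq0 a'0 w0) => a20; rewrite a'w a20 mulr0.
have [t Pt [x a2t]] : phi a' a2.
  apply: (amax a2).
  - split=> //; exists n.+1, (s * w); split; first exact: not_primeM.
    by rewrite mulrA as' -mulrA a'w exprSr; ring.
  - move=> z [e Pe [x zx]]; exists (e * w); first exact: not_primeM.
    by exists (v * x); rewrite mulrA zx mulrAC a'w; ring.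
  by exists 1 => //; exists 1.
apply: (not_primeM Pw Pt).
have -> : w * t = v * x.
  by apply: (mulfI a'0); rewrite mulrA a'w -mulrA a2t; ring.
exact: right_idealM.
Qed.
End LocalUniformizer.

Lemma dedekind_splitting : right_splitting D.
Proof.
move=> a b.
have [->|a0] := eqVneq a 0.
  by exists 1; split; [exists 0; rewrite mul0r mulr0|exists 0; rewrite subrr !mulr0].
have [->|b0] := eqVneq b 0.
  by exists 0; split; [exists 0; rewrite !mulr0|exists 0; rewrite mul0r mulr0].
pose J : set D := [set z | exists x y, [/\ z = x + y, principal b (a * x) & principal a (b * y)]].
have rJ : right_ideal J.
  split; first by exists 0, 0; split; [rewrite addr0|exists 0; rewrite !mulr0|exists 0; rewrite !mulr0].
  move=> e _ _ [x [y [-> [p xp] [q yq]]]] [x' [y' [-> [p' xp'] [q' yq']]]].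
  exists (x * e + x'), (y * e + y'); split; first by ring.
    by exists (p * e + p'); rewrite mulrDr mulrA xp xp'; ring.
  by exists (q * e + q'); rewrite mulrDr mulrA yq yq'; ring.
have [[x [y [def1 ax aby]]]|J1] := pselect (J 1).
  by exists x; split=> //; rewrite def1 addrC addKr.
have [P maxP sJP] := exists_maximal_ideal rJ J1.
have Pb : P b.
  by apply: sJP; exists b, 0; split; [rewrite addr0|exists a; rewrite mulrC|exists 0; rewrite !mulr0].
have [v val] := local_valuation maxP Pb b0.
have [n [s [a' [Ps Pa' as']]]] := val a a0.
have [m [t [b' [Pt Pb' bt]]]] := val b b0.
have nM := not_primeM maxP.
case/orP: (leq_total n m) => le_nm.
  case: (nM _ _ Pt Pa'); apply: sJP; exists 0, (t * a'); split; first by rewrite add0r.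
    by exists 0; rewrite !mulr0.
  exists (v ^+ (m - n) * b' * s).
  rewrite mulrA bt -{1}(subnK le_nm) exprD.
  have -> : a * (v ^+ (m - n) * b' * s) = v ^+ (m - n) * b' * (a * s) by ring.
  by rewrite as'; ring.
case: (nM _ _ Ps Pb'); apply: sJP; exists (s * b'), 0; split; first by rewrite addr0.
  exists (v ^+ (n - m) * a' * t).
  rewrite mulrA as' -{1}(subnK le_nm) exprD.
  have -> : b * (v ^+ (n - m) * a' * t) = v ^+ (n - m) * a' * (b * t) by ring.
  by rewrite bt; ring.
by exists 0; rewrite !mulr0.
Qed.
End DedekindSplitting.

(** * Rings without zero divisors as integral domains *)

(** The proofs are arguments of the type so that inference of its structures can
    recover them. *)
Definition comm_domain (R : nzRingType) (mulC : forall x y : R, x * y = y * x)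
  (domR : forall x y : R, x * y = 0 -> x = 0 \/ y = 0) : Type := R.

Section DomainStructure.
Variable R : nzRingType.
Hypothesis mulC : forall x y : R, x * y = y * x.
Hypothesis domR : forall x y : R, x * y = 0 -> x = 0 \/ y = 0.
Local Notation comm_domain := (comm_domain mulC domR).

HB.instance Definition _ := GRing.NzRing.on comm_domain.
HB.instance Definition _ :=
  GRing.PzRing_hasCommutativeMul.Build comm_domain mulC.

Let unit : {pred comm_domain} := fun x => `[< exists y, y * x = 1 >].
Let inv (x : comm_domain) : comm_domain :=
  if pselect (exists y, y * x = 1) is left ex_y then sval (cid ex_y) else x.

Lemma comm_domain_mulVx : {in unit, left_inverse 1 inv *%R}.
Proof.
move=> x /asboolP ex_y; rewrite /inv; case: pselect => // ex_y'.
exact: svalP (cid ex_y').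
Qed.

Lemma comm_domain_unitPl (x y : comm_domain) : y * x = 1 -> unit x.
Proof. by move=> yx; apply/asboolP; exists y. Qed.

Lemma comm_domain_inv_out : {in [predC unit], inv =1 id}.
Proof. by move=> x /asboolP nex; rewrite /inv; case: pselect. Qed.

HB.instance Definition _ := GRing.ComNzRing_hasMulInverse.Build comm_domain
  comm_domain_mulVx comm_domain_unitPl comm_domain_inv_out.

Lemma comm_domain_integral (x y : comm_domain) :
  x * y = 0 -> (x == 0) || (y == 0).
Proof. by case/domR => ->; rewrite eqxx ?orbT. Qed.

HB.instance Definition _ :=
  GRing.ComUnitRing_isIntegral.Build comm_domain comm_domain_integral.

End DomainStructure.

Lemma commutative_converse (R : nzRingType) : (forall x y : R, x * y = y * x) ->
  [/\ right_splitting R -> right_splitting R^c & right_acc R -> right_acc R^c].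
Proof.
move=> mulC.
have E (a : R) : @principal R^c a = principal a.
  by apply/seteqP; split=> x [r ->]; exists r; [exact: mulC|exact: mulC].
split=> [splitR a b | accR I rI].
  have [x [xa xb]] := splitR a b; exists x; rewrite !E.
  split; first by have -> : (a : R^c) * x = (a : R) * x by exact: mulC.
  by have -> : (b : R^c) * (1 - x) = (b : R) * (1 - x) by exact: mulC.
apply: accR => k; have [I0 IP] := rI k; split=> // a u v Iu Iv.
by rewrite mulC; apply: (IP a u v).
Qed.

(** * Finite products *)
Section Product.
Variables (A : nzRingType) (n : nat) (B : 'I_n -> nzRingType).
Variable f : forall i : 'I_n, {rmorphism A -> B i}.
Hypothesis bij_f : bijective (fun (a : A) (i : 'I_n) => f i a).

Lemma product_ext a b : (forall i, f i a = f i b) -> a = b.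
Proof.
by move=> eq_ab; apply: (bij_inj bij_f); apply: functional_extensionality_dep.
Qed.

Lemma product_surj (y : forall i, B i) : exists a, forall i, f i a = y i.
Proof.
by case: bij_f => g _ fg; exists (g y) => i; rewrite -[in RHS](fg y).
Qed.

Lemma product_surj1 i (y : B i) : exists a, f i a = y.
Proof.
have [a fa] := product_surj (dfwith (fun j => 0 : B j) y).
by exists a; rewrite fa dfwith_in.
Qed.

(** Coordinates in the different [B i] can be chosen simultaneously because each
    of them is represented by an element of the single type [A]. *)
Lemma product_choice (P : forall i, B i -> Prop) :
  (forall i, exists y, P i y) -> exists a, forall i, P i (f i a).
Proof.
move=> ex_y; have /choice [x Px] : forall i, exists a, P i (f i a).
  by move=> i; have [y Py] := ex_y i; have [a fa] := product_surj1 y; exists a; rewrite fa.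
have [a fa] := product_surj (fun i => f i (x i)).
by exists a => i; rewrite fa.
Qed.

Lemma product_principal a b :
  (forall i, principal (f i a) (f i b)) -> principal a b.
Proof.
move=> /product_choice [r fr]; exists r; apply: product_ext => i.
by rewrite rmorphM; exact: fr.
Qed.

Lemma product_splitting :
  (forall i, right_splitting (B i)) -> right_splitting A.
Proof.
move=> splitB a b.
have [x fx] := product_choice (fun i => splitB i (f i a) (f i b)).
by exists x; split; apply: product_principal => i; have [] := fx i;
  rewrite ?rmorphM ?rmorphB ?rmorph1.
Qed.

Lemma image_right_ideal i (I : set A) :
  right_ideal I -> right_ideal (fun y : B i => exists2 x, I x & f i x = y).
Proof.
case=> I0 IP; split; first by exists 0; rewrite ?rmorph0.
move=> b _ _ [x Ix <-] [y Iy <-]; have [a <-] := product_surj1 b.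
by exists (x * a + y); [apply: IP|rewrite rmorphD rmorphM].
Qed.

(** The images of a chain in the finitely many factors stabilise together.  An
    element [x] of a later term is then [\sum_i y i * d i], where [y i] lies in
    the earlier term and agrees with [x] at [i], and the [d i] are the
    idempotents of the product. *)
Lemma product_acc : (forall i, right_acc (B i)) -> right_acc A.
Proof.
move=> accB I rI incI.
pose img i k : set (B i) := fun y => exists2 x, I k x & f i x = y.
have /choice [k0 k0P] : forall i, exists k, forall m, (k <= m)%N -> img i m = img i k.
  move=> i; apply: (accB i) => k; first exact: image_right_ideal.
  by move=> y [x Ix <-]; exists x => //; apply: incI.
pose k := \max_i k0 i; exists k => m le_km.
apply/seteqP; split; last exact: chain_le.
move=> x Imx.
have /choice [d fd] : forall i, exists a, forall j, f j a = (i == j)%:R.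
  by move=> i; apply: (product_surj (fun j => (i == j)%:R)).
have /choice [y yP] : forall i, exists y, I k y /\ f i y = f i x.
  move=> i; have : img i m (f i x) by exists x.
  have le_k0 : (k0 i <= k)%N by apply: leq_bigmax.
  rewrite k0P; last exact: leq_trans le_km.
  by rewrite -(k0P _ _ le_k0) => -[y Iy yx]; exists y.
have -> : x = \sum_i y i * d i.
  apply: product_ext => j; rewrite rmorph_sum (bigD1 j) //= big1 => [|i ij].
    by rewrite rmorphM fd eqxx mulr1 (yP j).2 addr0.
  by rewrite rmorphM fd (negPf ij) mulr0.
elim/big_ind: _ => [|u v Iu Iv|i _]; first by case: (rI k).
  exact: right_idealD.
by apply: right_idealM => //; case: (yP i).
Qed.

Lemma product_centrally_essential :
  (forall i, centrally_essential (B i)) -> centrally_essential A.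
Proof.
move=> ceB a a0.
pose P i (c : B i) := [/\ ring_center c, ring_center (f i a * c) &
  f i a != 0 -> f i a * c != 0].
have [c cP] : exists c, forall i, P i (f i c).
  apply: product_choice => i; have [fa|fa] := eqVneq (f i a) 0.
    have cen0 : ring_center (0 : B i) by move=> x; rewrite /GRing.comm mulr0 mul0r.
    by exists 0; split; rewrite ?mulr0 // fa eqxx.
  by have [c [cc cd d0]] := ce_multiple (ceB i) fa; exists c.
have ac0 : a * c != 0.
  apply: contraNneq a0 => ac0; apply/eqP/product_ext => i; rewrite rmorph0.
  apply: contrapT => /eqP fa; have [_ _ /(_ fa)] := cP i.
  by rewrite -rmorphM ac0 rmorph0 eqxx.
have lift (z : A) : (forall i, ring_center (f i z)) -> ring_center z.
  by move=> cz x; apply: product_ext => i; rewrite !rmorphM; apply: cz.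
exists c, (a * c); split=> //.
- by apply: lift => i; have [] := cP i.
- by apply: lift => i; rewrite rmorphM; have [] := cP i.
- by apply: contraNneq ac0 => ->; rewrite mulr0.
Qed.
End Product.

Section ConverseMorphism.
Variables (A B : nzRingType) (f : {rmorphism A -> B}).
Definition converse_map : A^c -> B^c := f.
Lemma converse_map_zmod : zmod_morphism converse_map.
Proof. exact: (rmorphB f). Qed.
Lemma converse_map_monoid : monoid_morphism converse_map.
Proof. by split=> [|x y]; [exact: (rmorph1 f)|exact: (rmorphM f)]. Qed.
HB.instance Definition _ := GRing.isZmodMorphism.Build A^c B^c converse_map converse_map_zmod.
HB.instance Definition _ := GRing.isMonoidMorphism.Build A^c B^c converse_map converse_map_monoid.
End ConverseMorphism.

Lemma is_product_converse (A : nzRingType) (n : nat) (B : 'I_n -> nzRingType) :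
  is_product A B -> is_product A^c (fun i => (B i)^c).
Proof. by case=> f bij_f; exists (fun i => converse_map (f i)). Qed.

(** * Corner rings and the decomposition into indecomposable rings *)
Section SurjectiveImage.
Variables (A B : nzRingType) (f : {rmorphism A -> B}).
Hypothesis surj_f : forall y, exists x, f x = y.

Lemma surjective_splitting : right_splitting A -> right_splitting B.
Proof.
move=> splitA y z; have [[a <-] [b <-]] := (surj_f y, surj_f z).
have [x [[r xr] [s xs]]] := splitA a b; exists (f x).
split; [exists (f r)|exists (f s)]; rewrite -?(rmorph1 f) -?rmorphB -!rmorphM.
  by rewrite xr.
by rewrite xs.
Qed.

Lemma surjective_acc : right_acc A -> right_acc B.
Proof.
move=> accA I rI incI.
have [k kP] : exists k, forall m, (k <= m)%N -> f @^-1` I m = f @^-1` I k.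
  apply: accA => [k|k x]; last exact: incI.
  have [I0 IP] := rI k; split; first by rewrite /= rmorph0.
  by move=> a u v; rewrite /= rmorphD rmorphM; apply: IP.
exists k => m /kP eq_km; apply/seteqP; split=> y; have [x <-] := surj_f y => Ix.
  by have : (f @^-1` I m) x by []; rewrite eq_km.
by have : (f @^-1` I k) x by []; rewrite -eq_km.
Qed.
End SurjectiveImage.

Record corner_unit (A : nzRingType) := CornerUnit {
  cunit :> A;
  cunit_idem : cunit * cunit = cunit;
  cunit_central : ring_center cunit;
  cunit_neq0 : cunit != 0 }.

Section Corner.
Variables (A : nzRingType) (e : corner_unit A).

Local Notation u := (cunit e).

Record corner := Corner { corner_val :> A; _ : corner_val * u == corner_val }.
HB.instance Definition _ := [isSub for corner_val].
HB.instance Definition _ := [Choice of corner by <:].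

Lemma corner_proj_subproof (x : A) : x * u * u == x * u.
Proof. by rewrite -mulrA cunit_idem. Qed.

Definition corner_proj (x : A) : corner := Corner (corner_proj_subproof x).

Lemma corner_valE (x : corner) : (x : A) * u = x :> A.
Proof. by case: x => x /= /eqP. Qed.
Lemma corner_valEl (x : corner) : u * (x : A) = x :> A.
Proof. by rewrite cunit_central corner_valE. Qed.

Let zero := corner_proj 0.
Let opp (x : corner) := corner_proj (- (x : A)).
Let add (x y : corner) := corner_proj ((x : A) + (y : A)).
Let one := corner_proj 1.
Let mul (x y : corner) := corner_proj ((x : A) * (y : A)).

Let addE (x y : corner) : add x y = (x : A) + (y : A) :> A.
Proof. by rewrite /= mulrDl !corner_valE. Qed.
Let mulE (x y : corner) : mul x y = (x : A) * (y : A) :> A.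
Proof. by rewrite /= -mulrA corner_valE. Qed.

Let addA : associative add.
Proof. by move=> x y z; apply: val_inj; rewrite /= !(addE, mulrDl, corner_valE) addrA. Qed.
Let addC : commutative add.
Proof. by move=> x y; apply: val_inj; rewrite /= addrC. Qed.
Let add0 : left_id zero add.
Proof. by move=> x; apply: val_inj; rewrite /= mul0r add0r corner_valE. Qed.
Let addN : left_inverse zero opp add.
Proof. by move=> x; apply: val_inj; rewrite /= mulNr corner_valE addNr. Qed.

HB.instance Definition _ := GRing.isZmodule.Build corner addA addC add0 addN.

Let mulA : associative mul.
Proof. by move=> x y z; apply: val_inj; rewrite [LHS]mulE [RHS]mulE !mulE mulrA. Qed.
Let mul1 : left_id one mul.
Proof. by move=> x; apply: val_inj; rewrite /= mul1r -mulrA corner_valE corner_valEl. Qed.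
Let mulx1 : right_id one mul.
Proof. by move=> x; apply: val_inj; rewrite /= mul1r !corner_valE. Qed.
Let mulD : left_distributive mul add.
Proof.
by move=> x y z; apply: val_inj; rewrite [LHS]mulE [RHS]addE addE !mulE mulrDl.
Qed.
Let mulDr : right_distributive mul add.
Proof.
by move=> x y z; apply: val_inj; rewrite [LHS]mulE [RHS]addE addE !mulE mulrDr.
Qed.
Let one_neq0 : one != zero.
Proof. by rewrite -(inj_eq val_inj) /= mul1r mul0r cunit_neq0. Qed.

HB.instance Definition _ :=
  GRing.Zmodule_isNzRing.Build corner mulA mul1 mulx1 mulD mulDr one_neq0.

Lemma corner_val0 : (0 : corner) = 0 :> A. Proof. by rewrite /= mul0r. Qed.
Lemma corner_val1 : (1 : corner) = u :> A. Proof. by rewrite /= mul1r. Qed.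
Lemma corner_valM (x y : corner) : x * y = (x : A) * (y : A) :> A. Proof. exact: mulE. Qed.

Lemma corner_proj_zmod : zmod_morphism corner_proj.
Proof.
by move=> x y; apply: val_inj; rewrite /= !mulrDl !mulNr -!mulrA !cunit_idem.
Qed.
Lemma corner_proj_monoid : monoid_morphism corner_proj.
Proof.
split=> [|x y]; first exact: val_inj.
by apply: val_inj; rewrite /= -!mulrA cunit_idem (mulrA u) cunit_central -!mulrA cunit_idem.
Qed.
HB.instance Definition _ := GRing.isZmodMorphism.Build A corner corner_proj corner_proj_zmod.
HB.instance Definition _ := GRing.isMonoidMorphism.Build A corner corner_proj corner_proj_monoid.

Lemma corner_proj_surj (y : corner) : exists x, corner_proj x = y.
Proof. by exists y; apply: val_inj; rewrite /= corner_valE. Qed.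

Lemma corner_centrally_essential : centrally_essential A -> centrally_essential corner.
Proof.
move=> ceA x x0.
have vx0 : (x : A) != 0 by apply: contraNneq x0 => vx; apply/eqP/val_inj; rewrite /= mul0r.
have [c [cc cd d0]] := ce_multiple ceA vx0.
have xc : x * corner_proj c = (x : A) * c :> A.
  by rewrite corner_valM /= cc mulrA corner_valE -cc.
have xc0 : x * corner_proj c != 0.
  by apply: contraNneq d0 => xc_0; rewrite -xc xc_0 corner_val0.
exists (corner_proj c), (x * corner_proj c); split=> //.
- move=> y; apply: val_inj; rewrite [LHS]corner_valM [RHS]corner_valM /=.
  by rewrite -mulrA corner_valEl cc mulrA -cc -mulrA corner_valE.
- by move=> y; apply: val_inj; rewrite [LHS]corner_valM [RHS]corner_valM xc cd.
- by apply: contraNneq xc0 => ->; rewrite mulr0.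
Qed.
End Corner.

Section Decomposition.
Variable A : nzRingType.
Hypothesis accA : right_acc A.
Hypothesis idem_central : forall e : A, e * e = e -> ring_center e.
Implicit Types (e g x : A) (s : seq A).

Definition primitive e : Prop :=
  [/\ e * e = e, e != 0 & forall g, g * g = g -> g * e = g -> g = 0 \/ g = e].

(** The idempotent [e * g] lies below both, so if nonzero it equals both. *)
Lemma primitive_orthogonal e g : primitive e -> primitive g -> e != g -> e * g = 0.
Proof.
move=> [ee e0 eP] [gg g0 gP] neq.
have eg := idem_central ee g.
have egeg : e * g * (e * g) = e * g by rewrite {1}eg -mulrA (mulrA e) ee mulrA -eg -mulrA gg.
have [|//|eg_e] := eP _ egeg; first by rewrite eg -mulrA ee.
have [|//|eg_g] := gP _ egeg; first by rewrite -mulrA gg.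
by move: neq; rewrite -eg_e eg_g eqxx.
Qed.

(** When [e] and the entries of [s] are central idempotents, the latter
    primitive, this says that [e] is a sum of distinct entries of [s]; unlike
    an equation with a sum, it does not mind repetitions in [s]. *)
Definition detected_by s e : Prop :=
  forall a, (forall x, x \in s -> a * x = 0) -> a * e = 0.

(** Noetherian induction on [e] through the right ideal [(1 - e) A], which grows
    strictly when [e] is replaced by a proper idempotent part of it. *)
Lemma primitive_decomposition e : e * e = e ->
  exists2 s, forall x, x \in s -> primitive x & detected_by s e.
Proof.
move=> ee; apply: contrapT => bad_e.
pose bad g := g * g = g /\ ~ exists2 s, forall x, x \in s -> primitive x & detected_by s g.
have [{bad_e ee}e [ee bad_e] emax] := right_acc_max (P := bad)
  (phi := fun g => principal (1 - g)) accA (fun g _ => right_ideal_principal _)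
  (conj ee bad_e).
have e0 : e != 0.
  by apply/eqP => e0; apply: bad_e; exists [::] => // a _; rewrite e0 mulr0.
have good_part g : g * g = g -> g * e = g -> g != e ->
    exists2 s, forall x, x \in s -> primitive x & detected_by s g.
  move=> gg ge neq; apply: contrapT => bad_g.
  have [r def_r] : principal (1 - e) (1 - g).
    apply: (emax g) => //; last by exists 1; rewrite mulr1.
    move=> _ [r ->]; exists ((1 - e) * r); rewrite mulrA; congr (_ * r).
    by rewrite mulrBr mulr1 mulrBl mul1r ge opprB addrA subrK.
  have : e * (1 - g) = 0 by rewrite def_r mulrA mulrBr mulr1 ee subrr mul0r.
  by move/eqP; rewrite mulrBr mulr1 idem_central // ge subr_eq0 eq_sym (negPf neq).
apply: bad_e.
have [[g [gg ge g0 gne]]|prim_e] := pselect (exists g, [/\ g * g = g, g * e = g, g != 0 & g != e]).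
  have eg : e * g = g by rewrite idem_central.
  have [s1 s1P s1e] := good_part g gg ge gne.
  have [||| s2 s2P s2e] := good_part (e - g).
  - by rewrite mulrBl !mulrBr ee eg ge gg subrr subr0.
  - by rewrite mulrBl ee ge.
  - by rewrite -subr_eq0 addrAC subrr sub0r oppr_eq0.
  exists (s1 ++ s2) => [x|a a_s].
    by rewrite mem_cat => /orP [/s1P|/s2P].
  rewrite -[e](subrK g) mulrDr s2e ?s1e ?addr0 // => x xs; apply: a_s;
    by rewrite mem_cat xs ?orbT.
exists [:: e] => [x|a]; last by apply; rewrite inE.
rewrite inE => /eqP ->; split=> // g gg ge.
have [->|g0] := eqVneq g 0; first by left.
have [->|gne] := eqVneq g e; first by right.
by case: prim_e; exists g.
Qed.

Lemma primitive_units : exists n (E : 'I_n -> corner_unit A),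
  [/\ forall i, primitive (E i), injective (fun i => E i : A) &
      forall a, (forall i, a * (E i : A) = 0) -> a = 0].
Proof.
have [s sP s1] := primitive_decomposition (mulr1 1).
pose t := undup s.
have tP (i : 'I_(size t)) : primitive t`_i by apply/sP; rewrite -mem_undup mem_nth.
pose E i := let: And3 h1 h2 _ := tP i in CornerUnit h1 (idem_central h1) h2.
have EE i : E i = t`_i :> A by rewrite /E; case: (tP i).
exists (size t), E; split.
- by move=> i; rewrite EE.
- move=> i j; rewrite !EE => /eqP; rewrite nth_uniq ?undup_uniq //.
  by move/eqP/val_inj.
move=> a aE; rewrite -[a]mulr1; apply: s1 => x; rewrite -mem_undup => xs.
have xt : (index x t < size t)%N by rewrite index_mem.
by have := aE (Ordinal xt); rewrite EE /= nth_index.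
Qed.

Lemma primitive_corner_indecomposable (e : corner_unit A) :
  primitive e -> indecomposable (corner e).
Proof.
move=> [_ _ eP] g gg.
have vgg : (g : A) * (g : A) = g :> A by rewrite -corner_valM gg.
have [g0|ge] := eP _ vgg (corner_valE g).
  by left; apply: val_inj; rewrite [RHS]corner_val0.
by right; apply: val_inj; rewrite [RHS]corner_val1.
Qed.

Lemma corner_is_product n (E : 'I_n -> corner_unit A) :
  (forall i, primitive (E i)) -> injective (fun i => E i : A) ->
  (forall a, (forall i, a * (E i : A) = 0) -> a = 0) ->
  is_product A (fun i => corner (E i)).
Proof.
move=> primE injE detE.
have orth i j : i != j -> cunit (E i) * cunit (E j) = 0.
  by move=> ij; apply: primitive_orthogonal => //; apply: contra_neq ij => /injE.
have vE j (b : corner (E j)) i : (b : A) * cunit (E i) = if i == j then (b : A) else 0.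
  case: eqP => [->|/eqP ij]; first exact: corner_valE.
  by rewrite -(corner_valE b) -mulrA orth ?mulr0 // eq_sym.
exists (fun i => corner_proj (E i)); exists (fun b : forall i, corner (E i) => \sum_i (b i : A)).
  move=> a; apply/eqP; rewrite -subr_eq0; apply/eqP/detE => j.
  rewrite mulrBl mulr_suml (bigD1 j) //= big1 => [|i ij].
    by rewrite addr0 -mulrA cunit_idem subrr.
  by rewrite -mulrA orth ?mulr0.
move=> b; apply: functional_extensionality_dep => j; apply: val_inj => /=.
rewrite mulr_suml (bigD1 j) //= big1 => [|i ij]; first by rewrite addr0 corner_valE.
by rewrite vE eq_sym (negPf ij).
Qed.
End Decomposition.

(** * The classification *)
Definition uniserial_or_dedekind (R : nzRingType) : Prop :=
  [/\ uniserial_ring R, artinian_ring R & centrally_essential R] \/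
  commutative_dedekind_domain R.

Lemma indecomposable_classification (R : nzRingType) :
  right_splitting R -> right_acc R -> centrally_essential R -> indecomposable R ->
  uniserial_or_dedekind R.
Proof.
move=> splitR accR ceR indR.
have [[a [b [a0 b0 ab]]]|dom] := pselect (exists a b : R, [/\ a != 0, b != 0 & a * b = 0]).
  left; have localR := nilpotent_or_invertible ceR splitR accR indR a0 b0 ab.
  have chainR := local_right_chain ceR splitR accR indR a0 b0 ab.
  have [chainRc dccR dccRc] := local_chain_uniserial_artinian ceR chainR accR localR.
  by split=> //; split; [exact/right_uniserialP|exact/left_uniserialP|
    exact/right_artinianP|exact/left_artinianP].
right; have domR (a b : R) : a * b = 0 -> a = 0 \/ b = 0.
  move=> ab; have [->|a0] := eqVneq a 0; first by left.
  have [->|b0] := eqVneq b 0; first by right.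
  by case: dom; exists a, b.
have mulC := ce_domain_comm ceR domR.
pose D : idomainType := comm_domain mulC domR.
exists D, (idfun : {rmorphism R -> R}); split; first by exists id.
have splitD : right_splitting D by exact: splitR.
have accD : right_acc D by exact: accR.
split.
- split; first exact/right_noetherianP.
  by apply/left_noetherianP; case: (commutative_converse (R := D) (@mulrC D)) => _; apply.
- exact: splitting_integrally_closed.
- exact: splitting_prime_maximal.
Qed.

Definition distributive_noetherian_ce (R : nzRingType) : Prop :=
  [/\ distributive_ring R, noetherian_ring R & centrally_essential R].

Lemma domain_centrally_essential (D : idomainType) : centrally_essential D.
Proof.
move=> a a0; exists 1, a; split; rewrite ?oner_eq0 ?mulr1 //.
  by move=> x; exact: mulrC.
by move=> x; exact: mulrC.
Qed.

Lemma distributive_noetherianP (R : nzRingType) :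
  distributive_ring R /\ noetherian_ring R <->
  [/\ right_splitting R, right_acc R, right_splitting R^c & right_acc R^c].
Proof.
split=> [[[dr dl] [nr nl]]|[sr nr sl nl]].
  split; [exact/right_distributiveP|exact/right_noetherianP|
    exact/left_distributiveP|exact/left_noetherianP].
split; split; [exact/right_distributiveP|exact/left_distributiveP|
    exact/right_noetherianP|exact/left_noetherianP].
Qed.

Lemma product_distributive_noetherian_ce (A : nzRingType) n (B : 'I_n -> nzRingType) :
  is_product A B -> (forall i, distributive_noetherian_ce (B i)) ->
  distributive_noetherian_ce A.
Proof.
move=> prodAB facB.
have facB' i := (distributive_noetherianP (B i)).1
  (let: And3 d n _ := facB i in conj d n).
have [f bij_f] := prodAB; have [g bij_g] := is_product_converse prodAB.
have /distributive_noetherianP [dA nA] :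
    [/\ right_splitting A, right_acc A, right_splitting A^c & right_acc A^c].
  split; [apply: (product_splitting bij_f)|apply: (product_acc bij_f)|
    apply: (product_splitting bij_g)|apply: (product_acc bij_g)] => i;
    by case: (facB' i).
by split=> //; apply: (product_centrally_essential bij_f) => i; case: (facB i).
Qed.

Lemma uniserial_artinian_distributive_noetherian (R : nzRingType) :
  uniserial_ring R -> artinian_ring R -> centrally_essential R ->
  distributive_noetherian_ce R.
Proof.
move=> [/right_uniserialP ur /left_uniserialP ul] [/right_artinianP ar /left_artinianP al] ceR.
suff [] : distributive_ring R /\ noetherian_ring R by split.
apply/distributive_noetherianP; split.
- exact: right_chain_splitting.
- exact: left_dcc_right_acc.
- exact: right_chain_splitting.
- exact: (left_dcc_right_acc (R := R^c) (centrally_essential_converse ceR)).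
Qed.

Lemma dedekind_distributive_noetherian (R : nzRingType) :
  commutative_dedekind_domain R -> distributive_noetherian_ce R.
Proof.
move=> [D [f [[g fg gf] [[/right_noetherianP accD _] intD dim1]]]].
apply: (product_distributive_noetherian_ce (n := 1) (B := fun _ => D)).
  exists (fun _ => f); exists (fun y => g (y ord0)) => [x|y]; first exact: fg.
  by apply: functional_extensionality_dep => i; rewrite [i]ord1; apply: gf.
move=> _; have splitD := dedekind_splitting accD intD dim1.
have [split_c acc_c] := commutative_converse (@mulrC D).
have [dD nD] : distributive_ring D /\ noetherian_ring D.
  by apply/distributive_noetherianP; split=> //; [apply: split_c|apply: acc_c].
by split=> //; apply: domain_centrally_essential.
Qed.

Lemma uniserial_or_dedekind_decomposition (A : nzRingType) :
  right_splitting A -> right_acc A -> centrally_essential A ->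
  exists (n : nat) (B : 'I_n -> nzRingType),
    [/\ (0 < n)%N, is_product A B & forall i, uniserial_or_dedekind (B i)].
Proof.
move=> splitA accA ceA; have idemC := central_idempotent ceA.
have [n [E [primE injE detE]]] := primitive_units accA idemC.
exists n, (fun i => corner (E i)); split.
- case: n E primE injE detE => // E _ _ detE.
  have /eqP : (1 : A) = 0 by apply: detE => -[].
  by rewrite oner_eq0.
- exact: corner_is_product.
move=> i; apply: indecomposable_classification.
- exact: surjective_splitting (@corner_proj_surj _ _) splitA.
- exact: surjective_acc (@corner_proj_surj _ _) accA.
- exact: corner_centrally_essential.
- exact: primitive_corner_indecomposable.
Qed.

Lemma product_uniserial_or_dedekind (A : nzRingType) n (B : 'I_n -> nzRingType) :
  is_product A B -> (forall i, uniserial_or_dedekind (B i)) ->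
  distributive_noetherian_ce A.
Proof.
move=> prodAB facB; apply: (product_distributive_noetherian_ce prodAB) => i.
case: (facB i) => [[]|].
  exact: uniserial_artinian_distributive_noetherian.
exact: dedekind_distributive_noetherian.
Qed.

Theorem proposition2p7 (A : nzRingType) :
  ([/\ right_distributive_ring A, right_noetherian_ring A &
       centrally_essential A] <->
   exists (n : nat) (B : 'I_n -> nzRingType),
     [/\ (0 < n)%N,
         is_product A B &
         forall i : 'I_n,
           [/\ uniserial_ring (B i), artinian_ring (B i) &
               centrally_essential (B i)] \/
           commutative_dedekind_domain (B i)]) /\
  ([/\ right_distributive_ring A, right_noetherian_ring A &
       centrally_essential A] ->
   distributive_ring A /\ noetherian_ring A).
Proof.
have decompose : [/\ right_distributive_ring A, right_noetherian_ring A &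
     centrally_essential A] ->
   exists (n : nat) (B : 'I_n -> nzRingType),
     [/\ (0 < n)%N, is_product A B & forall i, uniserial_or_dedekind (B i)].
  move=> [/right_distributiveP splitA /right_noetherianP accA ceA].
  exact: uniserial_or_dedekind_decomposition.
split; first split=> // [[n [B [_ prodAB facB]]]].
  by have [[? _] [? _] ?] := product_uniserial_or_dedekind prodAB facB.
move=> /decompose [n [B [_ prodAB facB]]].
by have [] := product_uniserial_or_dedekind prodAB facB.
Qed.
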